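(* Let $X\subset\mathbb{C}^3$ be a quasi-homogeneous surface singularity with weights $(1,\omega_2,\omega_3)$, defined by a polynomial $F$ of one of the seven types $\mathrm{I},\dots,\mathrm{VII}$ listed in the context. For positive integers $n,m$ and complex numbers $c_1,c_2$ (with $c_2\neq0$) put $$S_{(c_1,c_2,n,m)}(Z_1,Z_2):=\sum_{j=1}^m\frac{Z_1^{(j-1)n}Z_2^{m-j}c_1^{j-1}}{c_2^{jn}}.$$ Then, as $(a,b,c)$ varies over all points of $X$ with $a\neq0$, the matrix factorization associated to the rank one generalized Wunram module on $X$ given by the non-singular $\mathbb{C}^*$-curve through $(a,b,c)$ is the pair of $2\times2$ matrices $(\mathrm{adj}(A),A)$ (a matrix factorization of the defining equation $-F$ of $X$), where $A=(m_{i,j})_{i,j\in\{1,2\}}$ with $$m_{1,1}=X_1^{\omega_2}b-X_2a^{\omega_2},\qquad m_{1,2}=X_3a^{\omega_3}-X_1^{\omega_3}c,$$ and $m_{2,1},m_{2,2}$ are given as follows. Write $S^{c}_{m}:=S_{(c,a,\omega_3,m)}(X_1,X_3)$ and $S^{b}_{m}:=S_{(b,a,\omega_2,m)}(X_1,X_2)$. Type $\mathrm{I}_{p,q,r}$: $m_{2,1}=S^c_r$, $\ m_{2,2}=S^b_q$. Type $\mathrm{II}_{p,q,r}$: $m_{2,1}=\frac{bX_1^{\omega_2}}{a^{\omega_2}}S^c_r$, $\ m_{2,2}=S^b_q+X_3^rS^b_1$. Type $\mathrm{III}_{p,q,r}$: $m_{2,1}=\frac{bX_1^{\omega_2}}{a^{\omega_2}}S^c_r+\frac{b^qX_1^{q\omega_2}}{a^{q\omega_2}}S^c_1$,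 $\ m_{2,2}=X_3S^b_q+X_3^rS^b_1$. Type $\mathrm{IV}_{p,q,r}$: $m_{2,1}=X_1S^c_r+\frac{b^qX_1^{q\omega_2}}{a^{q\omega_2}}S^c_1$, $\ m_{2,2}=X_3S^b_q$. Type $\mathrm{V}_{p,q,r}$: $m_{2,1}=X_1S^c_r+\frac{b^qX_1^{q\omega_2}}{a^{q\omega_2}}S^c_1$, $\ m_{2,2}=X_3S^b_q+X_1^pS^b_1$. Type $\mathrm{VI}_{p,q,r,b_2,b_3}$: $m_{2,1}=X_1S^c_r+\frac{b^{b_2}X_1^{b_2\omega_2}}{a^{b_2\omega_2}}S^c_{b_3}$, $\ m_{2,2}=X_1S^b_q+X_3^{b_3}S^b_{b_2}$. Type $\mathrm{VII}_{p,q,r,b_2,b_3}$: $m_{2,1}=X_1S^c_r+\frac{b^{b_2}X_1^{b_2\omega_2}}{a^{b_2\omega_2}}S^c_{b_3}$, $\ m_{2,2}=X_1S^b_q+X_3^{b_3}S^b_{b_2}+X_1^pS^b_1$.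
   Context: $\mathcal{O}_{\mathbb{C}^3}:=\mathbb{C}[[X_1,X_2,X_3]]$ and $\mathcal{O}_X:=\mathcal{O}_{\mathbb{C}^3}/(F)$; $X$ has an isolated singularity at the origin. Weights $(1,\omega_2,\omega_3)$ (positive integers) means that $F(\lambda X_1,\lambda^{\omega_2}X_2,\lambda^{\omega_3}X_3)=\lambda^dF(X_1,X_2,X_3)$ for all $\lambda\in\mathbb{C}^*$, for some positive integer $d$. The types (exponents are positive integers): $\mathrm{I}_{p,q,r}$: $F=X_1^p+X_2^q+X_3^r$. $\mathrm{II}_{p,q,r}$: $F=X_1^p+X_2^q+X_2X_3^r$, $q>1$. $\mathrm{III}_{p,q,r}$: $F=X_1^p+X_3X_2^q+X_2X_3^r$, $q>1$, $r>1$. $\mathrm{IV}_{p,q,r}$: $F=X_1^p+X_3X_2^q+X_1X_3^r$, $p>1$. $\mathrm{V}_{p,q,r}$: $F=X_2X_1^p+X_3X_2^q+X_1X_3^r$. $\mathrm{VI}_{p,q,r,b_2,b_3}$: $F=X_1^p+X_1X_2^q+X_1X_3^r+X_2^{b_2}X_3^{b_3}$, $(p-1)(qb_3+rb_2)=pqr$. $\mathrm{VII}_{p,q,r,b_2,b_3}$: $F=X_2X_1^p+X_1X_2^q+X_1X_3^r+X_2^{b_2}X_3^{b_3}$, $(p-1)(qb_3+rb_2)=r(pq-1)$. The $\mathbb{C}^*$-curve through a point $(a,b,c)\in X$, $(a,b,c)\ne 0$, is the closure $D$ in $X$ of the image of $\lambda\mapsto(a\lambda,b\lambda^{\omega_2},c\lambda^{\omega_3})$,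 $\lambda\in\mathbb{C}^*$; it is non-singular when $a\neq0$. The rank one generalized Wunram module given by a non-singular $\mathbb{C}^*$-curve $D$ is the rank one maximal Cohen–Macaulay $\mathcal{O}_X$-module $M$ having a section $s$ with cokernel of $\mathcal{O}_X\xrightarrow{\cdot s}M$ isomorphic to $\mathcal{O}_D$; dually there is an exact sequence $0\to M^\vee\to\mathcal{O}_X\to\mathcal{O}_D\to0$, i.e. $M=\mathrm{Hom}_{\mathcal{O}_X}(I_D,\mathcal{O}_X)$ with $I_D\subset\mathcal{O}_X$ the ideal of $D$. A matrix factorization of $G\in\mathcal{O}_{\mathbb{C}^3}$ is an ordered pair $(\Psi,\Phi)$ of $m\times m$ matrices over $\mathcal{O}_{\mathbb{C}^3}$ with $\Phi\Psi=\Psi\Phi=G\cdot\mathrm{Id}_m$. The matrix factorization associated to a maximal Cohen–Macaulay module $M$ is the pair $(\Psi,\Phi)$ for which $0\to\mathcal{O}_{\mathbb{C}^3}^{\oplus m}\xrightarrow{\Phi}\mathcal{O}_{\mathbb{C}^3}^{\oplus m}\to M\to0$ is exact (matrices acting on column vectors), with $G$ a defining equation of $X$. $\mathrm{adj}(A)$ is the adjoint (adjugate) matrix. *)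

(* Defs.v *)
From HB Require Import structures.
From mathcomp Require Import all_boot all_order all_algebra.
From mathcomp Require Import boolp classical_sets functions reals.
From mathcomp Require Import complex.
From mathcomp Require Import mpoly.

Set Implicit Arguments.
Unset Strict Implicit.
Unset Printing Implicit Defensive.

Import Order.TTheory GRing.Theory Num.Theory.
Local Open Scope ring_scope.
Local Open Scope quotient_scope.

(* K[[X_1, ..., X_n]]: a formal power series is its family of coefficients.     *)
Definition mps (n : nat) (K : Type) : Type := 'X_{1..n} -> K.

Notation "{ 'mps' K [ n ] }" := (mps n K)
  (at level 0, K at level 2, n at level 2, format "{ 'mps'  K [ n ] }").

Section PowerSeries.
Variables (n : nat) (K : comNzRingType).
Implicit Types (f g h : {mps K[n]}) (p q : {mpoly K[n]}) (m : 'X_{1..n}).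

HB.instance Definition _ := GRing.Zmodule.copy {mps K[n]} ('X_{1..n} -> K).

Definition mps_of p : {mps K[n]} := fun m => p@_m.

Definition mps_one : {mps K[n]} := mps_of 1.

(* The Cauchy product; the bounds only make the index type finite. *)
Definition mps_mul f g : {mps K[n]} := fun m =>
  \sum_(k : 'X_{1..n < (mdeg m).+1, (mdeg m).+1} | m == (k.1 + k.2)%MM)
    f k.1 * g k.2.

Definition mps_trunc (d : nat) f : {mpoly K[n]} :=
  \sum_(k : 'X_{1..n < d}) f k *: 'X_[k].

Lemma mcoeff_mps_trunc d f m : (mdeg m < d)%N -> (mps_trunc d f)@_m = f m.
Proof. by move=> md; rewrite mcoeff_mpoly. Qed.

Lemma mps_mulE (p q : {mpoly K[n]}) f g m :
    (forall k, (mdeg k <= mdeg m)%N -> p@_k = f k) ->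
    (forall k, (mdeg k <= mdeg m)%N -> q@_k = g k) ->
  mps_mul f g m = (p * q)@_m.
Proof.
move=> pf qg; rewrite mcoeffM; apply: eq_bigr => k _.
by rewrite pf ?qg // -ltnS bmdeg.
Qed.

Lemma mps_mul_trunc d f g m : (mdeg m < d)%N ->
  mps_mul f g m = (mps_trunc d f * mps_trunc d g)@_m.
Proof.
by move=> md; apply: mps_mulE => k km;
  rewrite mcoeff_mps_trunc // (leq_ltn_trans km).
Qed.

Lemma mps_mulA : associative mps_mul.
Proof.
move=> f g h; apply/funext => m; pose t := mps_trunc (mdeg m).+1.
have tE e k : (mdeg k <= mdeg m)%N -> (t e)@_k = e k.
  by move=> km; rewrite mcoeff_mps_trunc.
rewrite (@mps_mulE (t f) (t g * t h)) ?(@mps_mulE (t f * t g) (t h)) ?mulrA //.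
- by move=> k km; rewrite -mps_mul_trunc.
- exact: tE.
- exact: tE.
- by move=> k km; rewrite -mps_mul_trunc.
Qed.

Lemma mps_mulC : commutative mps_mul.
Proof.
move=> f g; apply/funext => m.
by rewrite !(mps_mul_trunc _ _ (ltnSn _)) mulrC.
Qed.

Lemma mps_mul1 : left_id mps_one mps_mul.
Proof.
move=> f; apply/funext => m; pose t := mps_trunc (mdeg m).+1.
rewrite (@mps_mulE 1 (t f)) ?mul1r ?mcoeff_mps_trunc //.
by move=> k km; rewrite mcoeff_mps_trunc.
Qed.

Lemma mps_mulDl : left_distributive mps_mul +%R.
Proof.
move=> f g h; apply/funext => m.
transitivity (\sum_(k : 'X_{1..n < (mdeg m).+1, (mdeg m).+1}
    | m == (k.1 + k.2)%MM) (f k.1 * h k.2 + g k.1 * h k.2)).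
  by apply: eq_bigr => k _; rewrite -mulrDl.
exact: big_split.
Qed.

Lemma mps_one_neq0 : mps_one != 0.
Proof.
apply/eqP => /(congr1 (fun f => f 0%MM)); rewrite /mps_one /mps_of mcoeff1 eqxx.
by move/eqP; rewrite oner_eq0.
Qed.

HB.instance Definition _ := GRing.Zmodule_isComNzRing.Build {mps K[n]}
  mps_mulA mps_mulC mps_mul1 mps_mulDl mps_one_neq0.

Lemma mps_of_is_additive : zmod_morphism mps_of.
Proof. by move=> p q; apply/funext => m; rewrite /mps_of mcoeffB. Qed.

Lemma mps_of_is_monoid_morphism : monoid_morphism mps_of.
Proof.
by split=> // p q; apply/funext => m; rewrite [RHS](@mps_mulE p q).
Qed.

HB.instance Definition _ := GRing.isZmodMorphism.Build _ _ mps_of mps_of_is_additive.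
HB.instance Definition _ :=
  GRing.isMonoidMorphism.Build _ _ mps_of mps_of_is_monoid_morphism.

End PowerSeries.

Definition principal (R : comNzRingType) (F : R) : {pred R} :=
  [pred x | `[< exists g, x = g * F >]].

Section PrincipalQuotient.
Variables (R : comNzRingType) (F : R).

Lemma principal_zmod_closed : zmod_closed (principal F).
Proof.
split=> [|x y]; first by apply/asboolP; exists 0; rewrite mul0r.
move=> /asboolP[g ->] /asboolP[h ->]; apply/asboolP.
by exists (g - h); rewrite mulrBl.
Qed.

HB.instance Definition _ :=
  GRing.isZmodClosed.Build R (principal F) principal_zmod_closed.

Definition quot_principal : Type := Quotient.quot (principal F).

HB.instance Definition _ := GRing.Zmodule.on quot_principal.
HB.instance Definition _ := EqQuotient.on quot_principal.

Definition qclass (x : R) : quot_principal := \pi_(Quotient.quot (principal F)) x.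

Lemma qclassE x y : (qclass x = qclass y) <-> (x - y \in principal F).
Proof. by rewrite Quotient.idealrBE; split=> [/eqP|/eqP]. Qed.

Lemma qclass_surj (u : quot_principal) : exists x, u = qclass x.
Proof. by exists (repr u); rewrite /qclass reprK. Qed.

Definition qmul (u v : quot_principal) : quot_principal :=
  qclass (repr u * repr v).

Lemma qclassM x y : qclass (x * y) = qmul (qclass x) (qclass y).
Proof.
apply/qclassE.
have reprE z : exists g, repr (qclass z) = z + g * F.
  have /qclassE/asboolP[g gE] : qclass (repr (qclass z)) = qclass z.
    by rewrite /qclass reprK.
  by exists g; rewrite -gE addrC subrK.
have [g ->] := reprE x; have [h ->] := reprE y.
apply/asboolP; exists (- (x * h + g * y + g * F * h)).
by rewrite mulrDl !mulrDr mulNr !mulrDl !opprD !addrA subrr add0r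
   -!mulrA [F * y]mulrC [F * (h * F)]mulrCA mulrA.
Qed.

Lemma qmulA : associative qmul.
Proof.
move=> u v w; have [x ->] := qclass_surj u; have [y ->] := qclass_surj v.
by have [z ->] := qclass_surj w; rewrite -!qclassM mulrA.
Qed.

Lemma qmulC : commutative qmul.
Proof. by move=> u v; rewrite /qmul mulrC. Qed.

Lemma qmul1 : left_id (qclass 1) qmul.
Proof. by move=> u; have [x ->] := qclass_surj u; rewrite -qclassM mul1r. Qed.

Lemma qclass_is_additive : zmod_morphism qclass.
Proof. by move=> x y; rewrite /qclass !piE. Qed.

Lemma qmulDl : left_distributive qmul +%R.
Proof.
move=> u v w; have [x ->] := qclass_surj u; have [y ->] := qclass_surj v.
have [z ->] := qclass_surj w.
have qD s t : qclass (s + t) = qclass s + qclass t by rewrite /qclass !piE.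
by rewrite -qD -!qclassM mulrDl qD.
Qed.

(* No properness assumption on (F), so the quotient may be the zero ring. *)
HB.instance Definition _ := GRing.Zmodule_isComPzRing.Build quot_principal
  qmulA qmulC qmul1 qmulDl.

HB.instance Definition _ :=
  GRing.isZmodMorphism.Build R quot_principal qclass qclass_is_additive.

Lemma qclass_is_monoid_morphism : monoid_morphism qclass.
Proof. by split=> // x y; exact: qclassM. Qed.

HB.instance Definition _ :=
  GRing.isMonoidMorphism.Build R quot_principal qclass qclass_is_monoid_morphism.

End PrincipalQuotient.

Section IdealGen.
Variables (R : comPzRingType) (A : set R).

Definition ideal_gen : {pred R^o} :=
  [pred x | `[< exists (s : nat) (u v : 'I_s -> R),
                 (forall i, A (v i)) /\ x = \sum_(i < s) u i * v i >]].

Lemma ideal_gen_submod_closed : submod_closed ideal_gen.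
Proof.
split=> [|r x y].
  apply/asboolP; exists 0%N, (fun=> 0), (fun=> 0).
  by split=> [[]//|]; rewrite big_ord0.
move=> /asboolP[s [u [v [Av ->]]]] /asboolP[t [u' [v' [Av' ->]]]].
apply/asboolP; exists (s + t)%N.
exists (fun i : 'I_(s + t) => match fintype.split i with inl j => r * u j | inr j => u' j end).
exists (fun i : 'I_(s + t) => match fintype.split i with inl j => v j | inr j => v' j end).
split=> [i|]; first by case: (fintype.split i).
rewrite big_split_ord /= scaler_sumr; congr (_ + _); apply: eq_bigr => i _.
  by rewrite (unsplitK (inl i)) -mulrA.
by rewrite (unsplitK (inr i)).
Qed.

HB.instance Definition _ :=
  GRing.isSubmodClosed.Build R R^o ideal_gen ideal_gen_submod_closed.

Definition ideal : Type := {x : R^o | x \in ideal_gen}.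

HB.instance Definition _ := SubChoice.on ideal.
HB.instance Definition _ := [SubChoice_isSubLmodule of ideal by <:].

End IdealGen.

Section LinearHom.
Variables (R : comPzRingType) (U V : lmodType R).

Definition is_linear : {pred U -> V} :=
  [pred f | `[< forall (r : R) x y, f (r *: x + y) = r *: f x + f y >]].

Lemma is_linear_submod_closed : submod_closed is_linear.
Proof.
split=> [|r f g].
  by apply/asboolP => r x y; rewrite [RHS]addr0 [RHS]scaler0.
move=> /asboolP fl /asboolP gl; apply/asboolP => t x y.
change (r *: f (t *: x + y) + g (t *: x + y) =
        t *: (r *: f x + g x) + (r *: f y + g y)).
by rewrite fl gl !scalerDr !scalerA [t * r]mulrC addrACA.
Qed.

HB.instance Definition _ :=
  GRing.isSubmodClosed.Build R (U -> V) is_linear is_linear_submod_closed.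

Definition linear_hom : Type := {f : U -> V | f \in is_linear}.

HB.instance Definition _ := SubChoice.on linear_hom.
HB.instance Definition _ := [SubChoice_isSubLmodule of linear_hom by <:].

End LinearHom.

Section MatrixFactorizations.
Variables (S : comNzRingType) (F : S).

Definition matrix_factorization (G : S) m (Psi Phi : 'M[S]_m) :=
  Phi *m Psi = G%:M /\ Psi *m Phi = G%:M.

(* 0 -> S^m -> S^m -> M -> 0 is exact, where the first map is Phi and M is     *)
(* an S-module through S -> S / (F).                                          *)
Definition presentation (M : lmodType (quot_principal F)) m (Phi : 'M[S]_m) :=
  exists phi : {linear 'cV[S]_m -> M | qclass F \; *:%R},
    [/\ injective (fun u : 'cV_m => Phi *m u),
        forall v : 'cV_m, phi v = 0 <-> exists u : 'cV_m, v = Phi *m u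
      & forall x : M, exists v, phi v = x].

(* G is any equation of the hypersurface, not necessarily F itself.            *)
Definition associated_mf (M : lmodType (quot_principal F)) (G : S)
    m (Psi Phi : 'M[S]_m) :=
  [/\ principal G =i principal F,
      matrix_factorization G Psi Phi
    & presentation M Phi].

End MatrixFactorizations.

Section Curves.
Variables (n : nat) (K : fieldType).
Implicit Types (F : {mpoly K[n]}) (A D X : set ('I_n -> K)) (w : 'I_n -> nat).

Definition hypersurface F : set ('I_n -> K) := [set x | F.@[x] = 0]%classic.

Definition vanishing_ideal D : set {mpoly K[n]} :=
  [set f | forall x, D x -> f.@[x] = 0]%classic.

Definition zariski_closure X A : set ('I_n -> K) :=
  [set x | X x /\ forall f, vanishing_ideal A f -> f.@[x] = 0]%classic.

Definition weighted_scale w (l : K) (x : 'I_n -> K) : 'I_n -> K :=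
  fun i => l ^+ w i * x i.

Definition quasi_homogeneous w F := exists2 d : nat, (0 < d)%N &
  forall l : K, l != 0 ->
    F \mPo [tuple (l ^+ w i) *: 'X_i | i < n] = l ^+ d *: F.

Definition Cstar_curve F w (x : 'I_n -> K) : set ('I_n -> K) :=
  zariski_closure (hypersurface F)
    [set weighted_scale w l x | l in [set l | l != 0]]%classic.

(* The ideal in the completed local ring at the origin is the extension of    *)
(* the ideal of polynomials vanishing on D.                                   *)
Definition curve_ideal F D : lmodType (quot_principal (mps_of F)) :=
  ideal [set qclass (mps_of F) (mps_of f) | f in vanishing_ideal D]%classic.

(* The module M is reflexive and M^\vee = I_D, by the dual of its section      *)
(* sequence 0 -> M^\vee -> O_X -> O_D -> 0; hence M = Hom(I_D, O_X).           *)
Definition wunram_module F D : lmodType (quot_principal (mps_of F)) :=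
  linear_hom (curve_ideal F D) (quot_principal (mps_of F))^o.

Definition singular_point F (x : 'I_n -> K) :=
  F.@[x] = 0 /\ forall i, (F^`M(i)).@[x] = 0.

End Curves.

(* As usual in singularity theory, a smooth origin is allowed: types such as  *)
(* X_1 + X_2^q + X_3^r are part of the classification.                        *)
Definition isolated_singularity (R : realType) n (F : {mpoly R[i][n]}) :=
  exists2 e : R[i], 0 < e &
    forall x : 'I_n -> R[i], (forall i, `|x i| < e) ->
      singular_point F x -> forall i, x i = 0.

Inductive sing_type :=
  | TypeI of nat & nat & nat
  | TypeII of nat & nat & nat
  | TypeIII of nat & nat & nat
  | TypeIV of nat & nat & nat
  | TypeV of nat & nat & nat
  | TypeVI of nat & nat & nat & nat & nat
  | TypeVII of nat & nat & nat & nat & nat.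

Definition admissible (t : sing_type) : bool :=
  match t with
  | TypeI p q r => [&& 0 < p, 0 < q & 0 < r]
  | TypeII p q r => [&& 0 < p, 1 < q & 0 < r]
  | TypeIII p q r => [&& 0 < p, 1 < q & 1 < r]
  | TypeIV p q r => [&& 1 < p, 0 < q & 0 < r]
  | TypeV p q r => [&& 0 < p, 0 < q & 0 < r]
  | TypeVI p q r b2 b3 =>
      [&& 0 < p, 0 < q, 0 < r, 0 < b2, 0 < b3
        & (p - 1) * (q * b3 + r * b2) == p * q * r]
  | TypeVII p q r b2 b3 =>
      [&& 0 < p, 0 < q, 0 < r, 0 < b2, 0 < b3
        & (p - 1) * (q * b3 + r * b2) == r * (p * q - 1)]
  end%N.

Definition vec3 (T : Type) (x y z : T) : 'I_3 -> T := tnth [tuple x; y; z].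

Section Types.
Variable K : fieldType.

Local Notation X1 := ('X_(@Ordinal 3 0 isT) : {mpoly K[3]}).
Local Notation X2 := ('X_(@Ordinal 3 1 isT) : {mpoly K[3]}).
Local Notation X3 := ('X_(@Ordinal 3 2 isT) : {mpoly K[3]}).

Definition sing_eq (t : sing_type) : {mpoly K[3]} :=
  match t with
  | TypeI p q r => X1 ^+ p + X2 ^+ q + X3 ^+ r
  | TypeII p q r => X1 ^+ p + X2 ^+ q + X2 * X3 ^+ r
  | TypeIII p q r => X1 ^+ p + X3 * X2 ^+ q + X2 * X3 ^+ r
  | TypeIV p q r => X1 ^+ p + X3 * X2 ^+ q + X1 * X3 ^+ r
  | TypeV p q r => X2 * X1 ^+ p + X3 * X2 ^+ q + X1 * X3 ^+ r
  | TypeVI p q r b2 b3 =>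
      X1 ^+ p + X1 * X2 ^+ q + X1 * X3 ^+ r + X2 ^+ b2 * X3 ^+ b3
  | TypeVII p q r b2 b3 =>
      X2 * X1 ^+ p + X1 * X2 ^+ q + X1 * X3 ^+ r + X2 ^+ b2 * X3 ^+ b3
  end.

Definition Ssum (c1 c2 : K) (n m : nat) (Z1 Z2 : {mpoly K[3]}) : {mpoly K[3]} :=
  \sum_(1 <= j < m.+1)
    (c1 ^+ (j - 1) / c2 ^+ (j * n)) *: (Z1 ^+ ((j - 1) * n) * Z2 ^+ (m - j)).

Section Entries.
Variables (w2 w3 : nat) (a b c : K).

Definition Sc (m : nat) := Ssum c a w3 m X1 X3.
Definition Sb (m : nat) := Ssum b a w2 m X1 X2.

Definition bX (k : nat) : {mpoly K[3]} :=
  (b ^+ k / a ^+ (k * w2)) *: X1 ^+ (k * w2).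

Definition entry11 : {mpoly K[3]} := b *: X1 ^+ w2 - a ^+ w2 *: X2.

Definition entry12 : {mpoly K[3]} := a ^+ w3 *: X3 - c *: X1 ^+ w3.

Definition entry21 (t : sing_type) : {mpoly K[3]} :=
  match t with
  | TypeI p q r => Sc r
  | TypeII p q r => bX 1 * Sc r
  | TypeIII p q r => bX 1 * Sc r + bX q * Sc 1
  | TypeIV p q r => X1 * Sc r + bX q * Sc 1
  | TypeV p q r => X1 * Sc r + bX q * Sc 1
  | TypeVI p q r b2 b3 => X1 * Sc r + bX b2 * Sc b3
  | TypeVII p q r b2 b3 => X1 * Sc r + bX b2 * Sc b3
  end.

Definition entry22 (t : sing_type) : {mpoly K[3]} :=
  match t with
  | TypeI p q r => Sb q
  | TypeII p q r => Sb q + X3 ^+ r * Sb 1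
  | TypeIII p q r => X3 * Sb q + X3 ^+ r * Sb 1
  | TypeIV p q r => X3 * Sb q
  | TypeV p q r => X3 * Sb q + X1 ^+ p * Sb 1
  | TypeVI p q r b2 b3 => X1 * Sb q + X3 ^+ b3 * Sb b2
  | TypeVII p q r b2 b3 => X1 * Sb q + X3 ^+ b3 * Sb b2 + X1 ^+ p * Sb 1
  end.

Definition mfA (t : sing_type) : 'M[{mps K[3]}]_2 :=
  map_mx (@mps_of 3 K)
    (\matrix_(i < 2, j < 2)
       if i == 0 then (if j == 0 then entry11 else entry12)
       else (if j == 0 then entry21 t else entry22 t)).

End Entries.
End Types.

(* Main.v *)
(* Let (f, g) be the first row of A and (k, h) the second. Replacing (X_2, X_3) by
   their values on the C*-curve sends F to 0, because F vanishes along the orbit,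
   and telescoping S_(c_1,c_2,n,m) shows that det A = f h - g k is this value
   minus F; so det A = -F. The ideal of the curve is (f, g), and f, g is a regular
   sequence in the power series ring. Hence a homomorphism I_D -> O_X is a pair of
   images (x, y) of (f, g) with g x = f y and h x = k y modulo F, and every such pair
   is v_0 (k, h) - v_1 (f, g), where (v_0, v_1) is unique up to the image of A. *)

Require Import Defs.
From HB Require Import structures.
From mathcomp Require Import all_boot all_order all_algebra.
From mathcomp Require Import boolp classical_sets functions reals.
From mathcomp Require Import complex.
From mathcomp Require Import mpoly.
From mathcomp Require Import ring zify.

Set Implicit Arguments.
Unset Strict Implicit.
Unset Printing Implicit Defensive.

Import Order.TTheory GRing.Theory Num.Theory.
Local Open Scope ring_scope.

(** * Products of formal power series and absence of zero divisors *)

Lemma mps_mulrE (n : nat) (K : comNzRingType) (f g : {mps K[n]}) :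
  f * g = mps_mul f g.
Proof. by []. Qed.

(** The monomial order is well-founded: if no lowest monomial existed, well-founded induction would
    make every coefficient vanish. *)
Lemma mps_neq0_lead (n : nat) (K : comNzRingType) (f : {mps K[n]}) : f != 0 ->
  exists2 m, f m != 0 & forall k, (k < m)%O -> f k = 0.
Proof.
move=> f0; apply: contrapT => nex; move/eqP: f0; apply.
apply/funext; apply: ltmwf => m IH; apply/eqP/negPn/negP => fm.
by apply: nex; exists m.
Qed.

(** If [m] and [k] are the lowest monomials of [f] and [g], any other pair of exponents with sum
    [m + k] has a first entry below [m] or a second entry below [k]. So the product has coefficient
    [f m * g k] at [m + k]. *)
Lemma mps_mulf_eq0 (n : nat) (K : idomainType) (f g : {mps K[n]}) :
  f * g = 0 -> f != 0 -> g = 0.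
Proof.
move=> fg0 /mps_neq0_lead[m fm f_lt]; apply/eqP/negPn/negP => /mps_neq0_lead[k gk g_lt].
have ltm : (mdeg m < (mdeg (m + k)%MM).+1)%N by rewrite ltnS mdegD leq_addr.
have ltk : (mdeg k < (mdeg (m + k)%MM).+1)%N by rewrite ltnS mdegD leq_addl.
suff : f m * g k = 0 by move/eqP; rewrite mulf_eq0 (negPf fm) (negPf gk).
move/(congr1 (fun h : {mps K[n]} => h (m + k)%MM)): fg0.
rewrite mps_mulrE /mps_mul (bigD1 (BMultinom ltm, BMultinom ltk)) //=.
rewrite big1 ?addr0 // => -[[u uP] [v vP]] /= /andP[/eqP uv].
rewrite -pair_eqE /pair_eq /= -!val_eqE /= => neq.
case: (ltgtP u m) => [/f_lt->|ltu|eu]; rewrite ?mul0r //.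
- case: (ltgtP v k) => [/g_lt->|ltv|ev]; rewrite ?mulr0 //.
    by have := ltm_add ltu ltv; rewrite -uv ltxx.
  by have := ltu; rewrite -(ltmc_add2l _ _ v) -uv ev ltxx.
- by move: uv neq; rewrite eu => /addmI <-; rewrite !eqxx.
Qed.

Lemma mps_mulX (n : nat) (K : comNzRingType) (f : {mps K[n]}) (k m : 'X_{1..n}) :
  (f * mps_of 'X_[k]) m = if (k <= m)%MM then f (m - k)%MM else 0.
Proof.
have -> : (f * mps_of 'X_[k]) m = (mps_trunc (mdeg m).+1 f * 'X_[k])@_m.
  by apply: mps_mulE => // u ud; rewrite mcoeff_mps_trunc.
case: ifP => km.
  rewrite -{1}(submK km) addmC mcoeffMX mcoeff_mps_trunc // ltnS.
  by rewrite -{2}(submK km) mdegD leq_addr.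
rewrite memN_msupp_eq0 // (perm_mem (msuppMX _ _)); apply/negP => /mapP[u _ mE].
by rewrite mE lem_addr in km.
Qed.

Lemma mps_mulD2 (n : nat) (K : comNzRingType) (f : {mps K[n]}) (x y : K)
    (p q : {mpoly K[n]}) m :
  (f * mps_of (x *: p + y *: q)) m
    = x * (f * mps_of p) m + y * (f * mps_of q) m.
Proof.
rewrite !mps_mulrE /mps_mul !mulr_sumr -big_split /=; apply: eq_bigr => k _.
rewrite /mps_of mcoeffD !mcoeffZ; ring.
Qed.

(** * Division by a binomial of degree one in a variable *)

Section Binomial.
Variables (n : nat) (K : fieldType) (i j : 'I_n) (k : nat) (x y : K).
Hypotheses (ij : i != j) (k0 : (0 < k)%N) (x0 : x != 0).

Local Notation e := (mps_of (x *: 'X_i + y *: 'X_j ^+ k)).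
Local Notation shift m := (m + U_(i) - U_(j) *+ k)%MM.

(** Read backwards, this is a recursion: as [x] is invertible, it recovers [f m] from the product
    and from a coefficient of [f] whose exponent of ['X_j] is smaller by [k]. *)
Lemma mps_mul_binomial (f : {mps K[n]}) m :
  (f * e) (m + U_(i))%MM
    = x * f m + (if (k <= m j)%N then y * f (shift m) else 0).
Proof.
rewrite mps_mulD2 mpolyXn !mps_mulX lem_addl addmK.
have -> : (U_(j) *+ k <= m + U_(i))%MM = (k <= m j)%N.
  apply/mnm_lepP/idP => [/(_ j)|km l].
    by rewrite mulmnE mnmDE !mnm1E eqxx (negPf ij) mul1n addn0.
  rewrite mulmnE mnmDE !mnm1E; case: eqP => [<-|_]; last by rewrite mul0n.
  by rewrite mul1n (leq_trans km) // leq_addr.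
by case: ifP; rewrite ?mulr0.
Qed.

Lemma shiftj (m : 'X_{1..n}) : (shift m) j = (m j - k)%N.
Proof. by rewrite mnmBE mulmnE mnmDE !mnm1E eqxx (negPf ij) mul1n addn0. Qed.

(** Strong induction on the exponent of ['X_j]: at [m + U_(i)] the product reads [x * f m] plus a
    term that already vanishes, because the shift lowers that exponent by [k > 0]. *)
Lemma mps_binomial_indep_eq0 (f : {mps K[n]}) :
  (forall m : 'X_{1..n}, (0 < m i)%N -> (f * e) m = 0) -> f = 0.
Proof.
move=> fe; apply/funext => m; change (f m = 0).
have [N] := ubnP (m j); elim: N m => // N IH m mN.
have /eqP := mps_mul_binomial f m.
rewrite fe; last by rewrite mnmDE mnm1E eqxx addn1.
case: ifP => km.
  rewrite (IH (shift m)) ?shiftj; last by lia.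
  by rewrite mulr0 addr0 eq_sym mulf_eq0 (negPf x0) => /eqP.
by rewrite addr0 eq_sym mulf_eq0 (negPf x0) => /eqP.
Qed.

(** Solves the recursion of [mps_mul_binomial] for the quotient. The argument [N] is fuel: each call
    lowers [m j] by [k > 0], so for [m j < N] the default value 0 is never reached. *)
Fixpoint binomial_quot (v : {mps K[n]}) (N : nat) (m : 'X_{1..n}) : K :=
  if N is N'.+1 then
    x^-1 * (v (m + U_(i))%MM
      - (if (k <= m j)%N then y * binomial_quot v N' (shift m) else 0))
  else 0.

Lemma binomial_quot_fuel v N N' (m : 'X_{1..n}) : (m j < N)%N -> (m j < N')%N ->
  binomial_quot v N m = binomial_quot v N' m.
Proof.
elim: N N' m => [//|N IH] [//|N'] m mN mN' /=.
case: ifP => // km; congr (_ * (_ - _ * _)).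
by apply: IH; rewrite shiftj; lia.
Qed.

(** Weierstrass division for degree one in ['X_i]: the quotient is chosen to match [v] at every
    monomial divisible by ['X_i], and whatever is left is free of ['X_i]. *)
Lemma mps_binomial_div (v : {mps K[n]}) : exists q r : {mps K[n]},
  v = q * e + r /\ forall m : 'X_{1..n}, (0 < m i)%N -> r m = 0.
Proof.
pose q : {mps K[n]} := fun m => binomial_quot v (m j).+1 m.
exists q, (v - q * e); split=> [|m mi]; first by rewrite addrC subrK.
have le1 : (U_(i) <= m)%MM by rewrite lep1mP -lt0n.
rewrite -(submK le1); set m' := (m - U_(i))%MM.
change (v (m' + U_(i))%MM - (q * e) (m' + U_(i))%MM = 0).
rewrite mps_mul_binomial {1}/q /= mulrA mulfV // mul1r.
case: ifP => km; last by rewrite !subr0 addr0 subrr.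
rewrite (@binomial_quot_fuel v (m' j) (shift m' j).+1) ?shiftj //; last by lia.
by rewrite /q shiftj subrK subrr.
Qed.

End Binomial.

(* Dividing [v] by [f] leaves a remainder free of ['X_i], like [g], and no nonzero
   multiple of [f] is free of ['X_i]. *)
Lemma mps_koszul (n : nat) (K : fieldType) (i l j : 'I_n) (k k' : nat)
    (x y x' y' : K) (u v : {mps K[n]}) :
    i != j -> l != j -> i != l -> (0 < k)%N -> (0 < k')%N -> x != 0 -> x' != 0 ->
    let f := mps_of (x *: 'X_i + y *: 'X_j ^+ k) in
    let g := mps_of (x' *: 'X_l + y' *: 'X_j ^+ k') in
  u * f + v * g = 0 -> exists t, u = t * g /\ v = - (t * f).
Proof.
move=> ij lj il k0 k'0 x0 x'0 f g uvfg.
have [q [r [vE r0]]] := mps_binomial_div y ij k0 x0 v.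
have rgE : r * g = (- (u + q * g)) * f.
  apply/eqP; rewrite -subr_eq0 -[X in _ == X]uvfg vE; apply/eqP; ring.
have rg0 (m : 'X_{1..n}) : (0 < m i)%N -> (r * g) m = 0.
  move=> mi; rewrite mps_mulD2 mpolyXn !mps_mulX.
  rewrite !(fun_if (fun z => _ * z)) !mulr0 !r0 ?mulr0 ?if_same ?addr0 //.
    by rewrite mnmBE mulmnE mnm1E eq_sym (negPf ij) mul0n subn0.
  by rewrite mnmBE mnm1E eq_sym (negPf il) subn0.
have s0 : - (u + q * g) = 0.
  by apply: (mps_binomial_indep_eq0 ij k0 x0 (y := y)) => m mi; rewrite -rgE rg0.
(* Now [r * g = 0], and the uniqueness lemma, used with ['X_l] in place of ['X_i], cancels [g]. *)
have r_eq0 : r = 0.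
  apply: (mps_binomial_indep_eq0 lj k'0 x'0 (y := y')) => m _.
  by change ((r * g) m = 0); rewrite rgE s0 mul0r.
exists (- q); split; last by rewrite vE r_eq0 addr0 mulNr opprK.
by move/eqP: s0; rewrite oppr_eq0 addr_eq0 mulNr => /eqP.
Qed.

(** * The dual of a two-generator ideal in a hypersurface ring *)

Lemma principalN (S : comNzRingType) (F : S) : principal (- F) =i principal F.
Proof.
move=> x; apply/asboolP/asboolP => -[g ->]; exists (- g); rewrite ?mulrNN //.
by rewrite mulNr mulrN.
Qed.

Section HomLemmas.
Variables (R : comPzRingType).

Lemma ideal_valP (A : set R) (r : R) (x y : ideal A) :
  val (r *: x + y) = r * val x + val y.
Proof. by []. Qed.

Variables (U V : lmodType R).
Implicit Types z : linear_hom U V.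

Lemma linear_homP z1 z2 : val z1 =1 val z2 -> z1 = z2.
Proof. by move=> z12; apply: val_inj; apply/funext. Qed.

Lemma linear_hom_valB z1 z2 u : val (z1 - z2) u = val z1 u - val z2 u.
Proof. by []. Qed.

Lemma linear_hom_comb z r s u v : val z (r *: u + s *: v) = r *: val z u + s *: val z v.
Proof.
have /asboolP zlin := valP z.
have z0 : val z 0 = 0 by rewrite -{1}[0](addNr 0) -scaleN1r zlin scaleN1r addNr.
by rewrite zlin -{1}[s *: v]addr0 zlin z0 addr0.
Qed.

End HomLemmas.

Lemma dual_valZ (R : comPzRingType) (U : lmodType R) r (z : linear_hom U R^o) u :
  val (r *: z) u = r * val z u.
Proof. by []. Qed.

Lemma dual_comb (R : comPzRingType) (U : lmodType R) (z : linear_hom U R^o) r s u v :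
  val z (r *: u + s *: v) = r * val z u + s * val z v.
Proof. exact: linear_hom_comb. Qed.

Section IdealPresentation.
Variables (S : comNzRingType) (F f g k h : S).
Hypotheses (detE : f * h - g * k = - F) (F_reg : forall x, x * F = 0 -> x = 0).
Hypothesis koszul :
  forall u v, u * f + v * g = 0 -> exists t, u = t * g /\ v = - (t * f).
Local Notation Q := (quot_principal F).
Local Notation q := (qclass F).
Variable A : set Q.
Hypothesis AE : forall x, x \in ideal_gen A <-> exists u v, x = q (u * f + v * g).
Local Notation I := (ideal A).
Local Notation M := (linear_hom I Q^o).

Lemma qclass_eq0 x : q x = 0 <-> exists w, x = w * F.
Proof.
have -> : 0 = q 0 by rewrite raddf0.
by rewrite qclassE subr0; split=> /asboolP.
Qed.

(** Makes the assignment of [k] to [f] and [h] to [g] well defined on the ideal. If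
    [u * f + v * g = w * F], adding [w * (h, - k)] to [(u, v)] gives a relation over [S], hence a
    multiple [t] of [(g, - f)]; the image is then [t * F]. *)
Lemma relation_image u v : q (u * f + v * g) = 0 -> q (u * k + v * h) = 0.
Proof.
move=> /qclass_eq0[w wE]; apply/qclass_eq0.
have [|t [uE vE]] := koszul (u := u + w * h) (v := v - w * k).
  have -> : (u + w * h) * f + (v - w * k) * g
    = (u * f + v * g) + w * (f * h - g * k) by ring.
  by rewrite wE detE; ring.
exists t; have -> : u = t * g - w * h by rewrite -uE; ring.
have -> : v = - (t * f) + w * k by rewrite -vE; ring.
have -> : F = - (f * h - g * k) by rewrite detE opprK.
ring.
Qed.

Lemma ideal_coord (x : I) : exists uv : S * S, val x = q (uv.1 * f + uv.2 * g).
Proof. by have /AE[u [v xE]] := valP x; exists (u, v). Qed.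

Definition coord (x : I) : S * S := projT1 (cid (ideal_coord x)).

Lemma coordE x : val x = q ((coord x).1 * f + (coord x).2 * g).
Proof. exact: projT2 (cid (ideal_coord x)). Qed.

(** The homomorphism with values [k] at [f] and [h] at [g], formally multiplication by the fraction
    k/f = h/g. The chosen coordinates are not unique; [second_hom_funE] shows that the value does
    not depend on them. *)
Definition second_hom_fun (x : I) : Q^o := q ((coord x).1 * k + (coord x).2 * h).

Lemma second_hom_funE x u v :
  val x = q (u * f + v * g) -> second_hom_fun x = q (u * k + v * h).
Proof.
rewrite coordE => /eqP; rewrite -subr_eq0 -raddfB => /eqP xE.
apply/eqP; rewrite -subr_eq0 -raddfB; apply/eqP.
rewrite (_ : _ - _ = ((coord x).1 - u) * k + ((coord x).2 - v) * h); last by ring.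
by apply: relation_image; rewrite -[RHS]xE; congr (q _); ring.
Qed.

Lemma second_hom_linear : second_hom_fun \in @is_linear Q I Q^o.
Proof.
apply/asboolP => r x y; have [s ->] := qclass_surj r.
rewrite (@second_hom_funE _ (s * (coord x).1 + (coord y).1)
   (s * (coord x).2 + (coord y).2)).
  change (q s *: second_hom_fun x) with (q s * second_hom_fun x).
  by rewrite /second_hom_fun -rmorphM -raddfD; congr (q _); ring.
by rewrite ideal_valP !coordE -rmorphM -raddfD; congr (q _); ring.
Qed.

Definition second_hom : M := Sub second_hom_fun second_hom_linear.

Lemma inclusion_linear : (fun x : I => val x : Q^o) \in @is_linear Q I Q^o.
Proof. by apply/asboolP. Qed.

Definition inclusion_hom : M := Sub (fun x : I => val x : Q^o) inclusion_linear.

(** The surjection of the presentation: [second_hom] and the inclusion generate the dual. The minus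
    sign makes the columns [(f, k)] and [(g, h)] of the matrix the relations between them. *)
Definition cover (v : 'cV[S]_2) : M :=
  q (v 0 0) *: second_hom - q (v 1 0) *: inclusion_hom.

Lemma coverE v x : val (cover v) x = q
  ((v 0 0 * k - v 1 0 * f) * (coord x).1 + (v 0 0 * h - v 1 0 * g) * (coord x).2).
Proof.
change (q (v 0 0) * second_hom_fun x - q (v 1 0) * val x = q
  ((v 0 0 * k - v 1 0 * f) * (coord x).1 + (v 0 0 * h - v 1 0 * g) * (coord x).2)).
by rewrite coordE -!rmorphM -raddfB; congr (q _); ring.
Qed.

Lemma cover_zmod : zmod_morphism cover.
Proof.
move=> u v; apply: linear_homP => x.
by rewrite coverE linear_hom_valB !coverE -raddfB !mxE; congr (q _); ring.
Qed.

Lemma cover_scalable : scalable_for (q \; *:%R) cover.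
Proof.
move=> s v; apply: linear_homP => x.
have -> : (q \; *:%R) s (cover v) = q s *: cover v by [].
by rewrite coverE dual_valZ coverE -rmorphM !mxE; congr (q _); ring.
Qed.

HB.instance Definition _ := GRing.isZmodMorphism.Build _ _ cover cover_zmod.
HB.instance Definition _ := GRing.isScalable.Build _ _ _ _ cover cover_scalable.

Lemma ideal_elt u v : exists x : I, val x = q (u * f + v * g).
Proof.
have xI : q (u * f + v * g) \in ideal_gen A by apply/AE; exists u, v.
by exists (Sub (q (u * f + v * g) : Q^o) xI).
Qed.

Lemma cover_val v (x : I) u w : val x = q (u * f + w * g) ->
  val (cover v) x = q ((v 0 0 * k - v 1 0 * f) * u + (v 0 0 * h - v 1 0 * g) * w).
Proof.
move=> xE.
change (q (v 0 0) * second_hom_fun x - q (v 1 0) * val x = q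
  ((v 0 0 * k - v 1 0 * f) * u + (v 0 0 * h - v 1 0 * g) * w)).
by rewrite (second_hom_funE xE) xE -!rmorphM -raddfB; congr (q _); ring.
Qed.

Lemma F_cancel x y : x * F = y * F -> x = y.
Proof.
move=> xy; apply/eqP; rewrite -subr_eq0; apply/eqP/F_reg.
by rewrite mulrBl xy subrr.
Qed.

Lemma FE : F = g * k - f * h.
Proof. by rewrite -[F]opprK -detE opprB. Qed.

Lemma cover_surj (z : M) : exists v, cover v = z.
Proof.
have [ef efE] := ideal_elt 1 0; have [eg egE] := ideal_elt 0 1.
have [x xE] := qclass_surj (val z ef); have [y yE] := qclass_surj (val z eg).
have zE (e : I) u w : val e = q (u * f + w * g) -> val z e = q (u * x + w * y).
  move=> eE; have -> : e = q u *: ef + q w *: eg.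
    apply: val_inj; rewrite eE -[q w *: eg]addr0 !ideal_valP efE egE addr0.
    by rewrite -!rmorphM -raddfD; congr (q _); ring.
  rewrite dual_comb xE yE.
  by rewrite -!rmorphM -raddfD.
(* Both kinds of combination are zero in the quotient, so the zero of the ideal has the coordinates
   [(u, w)] as well as [(0, 0)]; [z] takes one value on it. *)
have zero_rel u w : u * f + w * g = 0 \/ u * f + w * g = - F ->
    exists t, u * x + w * y = t * F.
  move=> uw; apply/qclass_eq0; rewrite -(zE 0) //; last first.
    apply/esym/qclass_eq0; case: uw => ->; [exists 0 | exists (- 1)]; ring.
  by rewrite (zE _ 0 0) ?mul0r ?addr0 ?raddf0.
have [|a aE] := zero_rel h (- k).
  by right; rewrite -detE; ring.
have [|b bE] := zero_rel g (- f).
  by left; ring.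
(* The two relations read [h * x - k * y = a * F] and [g * x - f * y = b * F]. Since
   [F = g * k - f * h], Cramer's rule followed by cancellation of [F] expresses [x] and [y] through
   [b] and [a]. *)
exists (\col_i if i == 0 then b else a).
apply: linear_homP => e; rewrite coverE !mxE /=.
rewrite (zE e _ _ (coordE e)); congr (q _).
have -> : x = b * k - a * f.
  apply: F_cancel; rewrite mulrBl.
  have -> : b * k * F = k * (b * F) by ring.
  have -> : a * f * F = f * (a * F) by ring.
  by rewrite -aE -bE FE; ring.
have -> : y = b * h - a * g.
  apply: F_cancel; rewrite mulrBl.
  have -> : b * h * F = h * (b * F) by ring.
  have -> : a * g * F = g * (a * F) by ring.
  by rewrite -aE -bE FE; ring.
ring.
Qed.

Lemma cover_ker v : cover v = 0 <-> exists s t,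
  v 0 0 = f * s + g * t /\ v 1 0 = k * s + h * t.
Proof.
split=> [v0|[s [t [v0E v1E]]]]; last first.
  apply: linear_homP => x; rewrite coverE v0E v1E.
  transitivity (0 : Q); last by [].
  apply/qclass_eq0; exists (t * (coord x).1 - s * (coord x).2); rewrite FE; ring.
have rel u w : exists z, (v 0 0 * k - v 1 0 * f) * u + (v 0 0 * h - v 1 0 * g) * w = z * F.
  have [x xE] := ideal_elt u w; apply/qclass_eq0.
  by rewrite -(cover_val v xE) v0.
(* Evaluation at the two generators gives [v 0 0 * k - v 1 0 * f = a * F] and
   [v 0 0 * h - v 1 0 * g = b * F]; Cramer's rule now solves for the entries of [v]. *)
have [a aE] := rel 1 0; have [b bE] := rel 0 1.
exists (- b), a; split; apply: F_cancel.
  have -> : (f * - b + g * a) * F = g * (a * F) - f * (b * F) by ring.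
  by rewrite -aE -bE FE; ring.
have -> : (k * - b + h * a) * F = h * (a * F) - k * (b * F) by ring.
by rewrite -aE -bE FE; ring.
Qed.

Lemma mulmx2E (P : 'M[S]_2) (u : 'cV[S]_2) i :
  (P *m u) i 0 = P i 0 * u 0 0 + P i 1 * u 1 0.
Proof.
rewrite mxE big_ord_recl big_ord1; congr (_ + P i _ * u _ _); exact: val_inj.
Qed.

Lemma det_mx2 (P : 'M[S]_2) : \det P = P 0 0 * P 1 1 - P 0 1 * P 1 0.
Proof.
rewrite (expand_det_row _ 0) big_ord_recl big_ord1 /cofactor !det_mx11 !mxE /=.
have l0 : lift ord0 0 = 1 :> 'I_2 by apply: val_inj.
have l1 : lift (lift ord0 ord0) 0 = 0 :> 'I_2 by apply: val_inj.
by rewrite l1 l0 expr0 mul1r expr1 mulN1r mulrN.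
Qed.

Lemma cV2P (u v : 'cV[S]_2) : u 0 0 = v 0 0 -> u 1 0 = v 1 0 -> u = v.
Proof.
move=> u0 u1; apply/matrixP => i j; rewrite ord1.
by case: i => [[|[|//]]] ilt; [move: u0 | move: u1]; congr (u _ _ = v _ _); apply: val_inj.
Qed.

Lemma hom_ideal_mf (P : 'M[S]_2) :
    P 0 0 = f -> P 0 1 = g -> P 1 0 = k -> P 1 1 = h ->
  @associated_mf S F M (- F) 2 (\adj P) P.
Proof.
move=> P00 P01 P10 P11.
have detP : \det P = - F.
  by rewrite det_mx2 P00 P01 P10 P11.
split; first exact: principalN.
  by split; rewrite ?mul_mx_adj ?mul_adj_mx detP.
exists cover; split; last exact: cover_surj.
  (* Injectivity: multiplying by the adjugate turns [P] into the scalar [- F], which can be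
     cancelled. *)
  move=> u v /(congr1 (mulmx (\adj P))).
  rewrite !mulmxA mul_adj_mx detP !mul_scalar_mx => /matrixP uv.
  apply/matrixP => i j; apply: F_cancel; apply: oppr_inj.
  by have := uv i j; rewrite !mxE !mulNr ![F * _]mulrC.
move=> v; rewrite -[GRing.Linear.sort _ v]/(cover v) cover_ker.
split=> [[s [t [v0 v1]]]|[u ->]].
  exists (\col_i if i == 0 then s else t).
  by apply: cV2P; rewrite mulmx2E !mxE /= ?P00 ?P01 ?P10 ?P11.
by exists (u 0 0), (u 1 0); rewrite !mulmx2E P00 P01 P10 P11.
Qed.

End IdealPresentation.

(** * Substitution along the orbit and the determinant *)

Lemma poly_eq0_nonzero (K : numFieldType) (p : {poly K}) :
  (forall x : K, x != 0 -> p.[x] = 0) -> p = 0.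
Proof.
move=> p0; apply/eqP/negPn/negP => pn0.
(* The points 1, ..., [size p] are nonzero and distinct in characteristic zero: one more root than
   the degree allows. *)
have := max_poly_roots (rs := [seq i.+1%:R | i <- iota 0 (size p)]) pn0.
rewrite size_map size_iota ltnn => H; suff : false by []; apply: H.
  apply/allP => _ /mapP[i _ ->]; apply/rootP/p0; by rewrite pnatr_eq0.
rewrite map_inj_uniq ?iota_uniq // => i j /eqP.
by rewrite eqr_nat => /eqP[].
Qed.

(** With C = (c1 / c2^n) Z1^n, the first factor is c2^n (C - Z2), and c2^n times the sum is the
    geometric sum in the factorization of C^m - Z2^m. *)
Lemma Ssum_telescope (K : fieldType) (c1 c2 : K) (n m : nat) (Z1 Z2 : {mpoly K[3]}) :
    c2 != 0 ->
  (c1 *: Z1 ^+ n - c2 ^+ n *: Z2) * Ssum c1 c2 n m Z1 Z2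
    = ((c1 / c2 ^+ n) *: Z1 ^+ n) ^+ m - Z2 ^+ m.
Proof.
move=> c20; have cn0 : c2 ^+ n != 0 by rewrite expf_neq0.
set C := ((c1 / _) *: _ ^+ n).
have -> : c1 *: Z1 ^+ n - c2 ^+ n *: Z2 = c2 ^+ n *: (C - Z2).
  by rewrite scalerBr /C scalerA [_ * (c1 / _)]mulrC divfK.
rewrite -scalerAl scalerAr -[C ^+ m - _]opprB subrXX -mulNr opprB; congr (_ * _).
rewrite /Ssum big_add1 /= big_mkord scaler_sumr; apply: eq_bigr => j _.
rewrite subn1 /= scalerA /C exprZn -exprM [(n * j)%N]mulnC -scalerAr.
have -> : (m - j.+1)%N = (m.-1 - j)%N by lia.
rewrite [Z2 ^+ _ * _]mulrC (_ : _ * _ = (c1 / c2 ^+ n) ^+ j) //.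
rewrite mulSn exprD expr_div_n -exprM [(n * j)%N]mulnC; field.
by rewrite !expf_neq0.
Qed.

Section Orbit.
Variables (K : numFieldType) (w2 w3 : nat) (a b c : K).
Hypothesis a0 : a != 0.

Local Notation X1 := ('X_(@Ordinal 3 0 isT) : {mpoly K[3]}).
Local Notation X2 := ('X_(@Ordinal 3 1 isT) : {mpoly K[3]}).
Local Notation X3 := ('X_(@Ordinal 3 2 isT) : {mpoly K[3]}).
Local Notation e11 := (entry11 w2 a b).
Local Notation e12 := (entry12 w3 a c).
Local Notation orbit_pt l := (weighted_scale (vec3 1%N w2 w3) l (vec3 a b c)).
Local Notation B := ((b / a ^+ w2) *: X1 ^+ w2).
Local Notation C := ((c / a ^+ w3) *: X1 ^+ w3).

(** The orbit reparametrized by its first coordinate instead of the scaling factor, which is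
    possible as [a] is nonzero. *)
Definition curve_param : 'I_3 -> {poly K} :=
  vec3 'X ((b / a ^+ w2) *: 'X^w2) ((c / a ^+ w3) *: 'X^w3).

Definition along_curve : {rmorphism {mpoly K[3]} -> {poly K}} :=
  mmap (polyC : {rmorphism K -> {poly K}}) curve_param.

(** Puts the variable [X1] for the curve parameter. Composed after [along_curve], it fixes [X1] and
    sends [X2] to [B] and [X3] to [C]. *)
Definition X1_poly : {rmorphism {poly K} -> {mpoly K[3]}} :=
  horner_eval X1 \o map_poly (@mpolyC 3 K).

Lemma horner_along_curve h x : (along_curve h).[x] = h.@[fun i => (curve_param i).[x]].
Proof.
rewrite mevalE /along_curve /= /mmap horner_sum; apply: eq_bigr => m _.
rewrite hornerM hornerC /mmap1 horner_prod; congr (_ * _).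
by apply: eq_bigr => i _; rewrite horner_exp.
Qed.

Lemma along_curve_eq0 h : (forall l : K, l != 0 -> h.@[orbit_pt l] = 0) -> along_curve h = 0.
Proof.
move=> h0; apply: poly_eq0_nonzero => x x0; rewrite horner_along_curve.
(* The point with parameter [x] is the orbit point with scaling factor [x / a]. *)
rewrite -[RHS](h0 (x / a)) ?mulf_neq0 ?invr_eq0 //; apply: meval_eq => i.
rewrite /weighted_scale /curve_param /vec3.
case: i => [[|[|[|//]]] ilt]; rewrite /tnth /=.
- by rewrite hornerX expr1 divfK.
- by rewrite hornerZ hornerXn expr_div_n; field; rewrite expf_neq0.
- by rewrite hornerZ hornerXn expr_div_n; field; rewrite expf_neq0.
Qed.

Lemma along_curveC x : along_curve x%:MP = x%:P.
Proof. exact: mmapC. Qed.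

Lemma along_curveX i : along_curve 'X_i = curve_param i.
Proof. by rewrite [LHS]mmapX mmap1U. Qed.

Lemma X1_polyC x : X1_poly x%:P = x%:MP.
Proof. by rewrite /X1_poly /= map_polyC /horner_eval hornerC. Qed.

Lemma X1_polyXn x n : X1_poly (x *: 'X^n) = x *: X1 ^+ n.
Proof.
rewrite -mul_polyC rmorphM X1_polyC rmorphXn /= map_polyX /horner_eval hornerX.
by rewrite mul_mpolyC.
Qed.

Lemma along_curveX1 : X1_poly (along_curve X1) = X1.
Proof.
rewrite along_curveX /curve_param /vec3 /tnth /=.
by rewrite map_polyX /horner_eval hornerX.
Qed.

Lemma along_curveX2 : X1_poly (along_curve X2) = B.
Proof. by rewrite along_curveX -X1_polyXn. Qed.

Lemma along_curveX3 : X1_poly (along_curve X3) = C.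
Proof. by rewrite along_curveX -X1_polyXn. Qed.

(** Modulo [e11] and [e12] the substitution is the identity: this holds for constants and variables,
    [X2 - B] and [X3 - C] being scalar multiples of [e11] and [e12], and it passes to sums and
    products. *)
Lemma sub_along_curve h : exists u v,
  h - X1_poly (along_curve h) = u * e11 + v * e12.
Proof.
pose J (h : {mpoly K[3]}) := exists u v,
  h - X1_poly (along_curve h) = u * e11 + v * e12.
have JC x : J x%:MP.
  by exists 0, 0; rewrite along_curveC X1_polyC subrr !mul0r addr0.
have JD f g : J f -> J g -> J (f + g).
  move=> [u [v fE]] [u' [v' gE]]; exists (u + u'), (v + v').
  rewrite !rmorphD opprD addrACA fE gE; ring.
have JM f g : J f -> J g -> J (f * g).
  move=> [u [v fE]] [u' [v' gE]]; rewrite /J !rmorphM.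
  set f' := X1_poly _ in fE *; set g' := X1_poly _ in gE *.
  exists (u * g + f' * u'), (v * g + f' * v').
  have -> : f * g - f' * g' = (f - f') * g + f' * (g - g') by ring.
  rewrite fE gE; ring.
have JX i : J 'X_i.
  case: i => [[|[|[|//]]] ilt].
  - rewrite (_ : Ordinal _ = Ordinal (isT : (0 < 3)%N)); last exact: val_inj.
    by exists 0, 0; rewrite along_curveX1 subrr !mul0r addr0.
  - rewrite (_ : Ordinal _ = Ordinal (isT : (1 < 3)%N)); last exact: val_inj.
    exists (- (a ^+ w2)^-1)%:MP, 0; rewrite along_curveX2 /e11 mul0r addr0 mul_mpolyC.
    rewrite scalerBr !scalerA !mulNr !scaleNr mulVf ?expf_neq0 // scale1r opprK.
    by rewrite addrC [_^-1 * b]mulrC.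
  - rewrite (_ : Ordinal _ = Ordinal (isT : (2 < 3)%N)); last exact: val_inj.
    exists 0, ((a ^+ w3)^-1)%:MP; rewrite along_curveX3 /e12 mul0r add0r mul_mpolyC.
    by rewrite scalerBr !scalerA mulVf ?expf_neq0 // scale1r [_^-1 * c]mulrC.
have JXn i n : J ('X_i ^+ n).
  elim: n => [|n IH]; first by rewrite expr0 -mpolyC1; apply: JC.
  by rewrite exprS; apply: JM.
elim/mpolyind: h => [|x m p _ _ Jp]; first by rewrite -(mpolyC0 3 K); apply: JC.
apply: JD Jp; rewrite -mul_mpolyC; apply: (JM) => //; rewrite mpolyXE_id.
by apply: (big_ind J) => [||i _]; [rewrite -mpolyC1; apply: JC | exact: JM | apply: JXn].
Qed.

Lemma vanishing_curve_ideal h : (forall l : K, l != 0 -> h.@[orbit_pt l] = 0) ->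
  exists u v, h = u * e11 + v * e12.
Proof.
move=> /along_curve_eq0 h0; have [u [v]] := sub_along_curve h.
by rewrite h0 raddf0 subr0; exists u, v.
Qed.

(** Telescoping writes every power of [X2] or [X3] as its value on the curve plus a multiple of
    [e11] or [e12]; the second row collects exactly these multipliers, so each type becomes a ring
    identity. *)
Lemma entries_det (theta : {rmorphism {mpoly K[3]} -> {mpoly K[3]}}) t :
    theta X1 = X1 -> theta X2 = B -> theta X3 = C ->
  e11 * entry22 w2 a b t - e12 * entry21 w2 w3 a b c t
    = theta (sing_eq K t) - sing_eq K t.
Proof.
move=> th1 th2 th3.
have SbE m : X2 ^+ m = B ^+ m - e11 * Sb w2 a b m.
  by rewrite Ssum_telescope // opprB addrC subrK.
have ScE m : X3 ^+ m = C ^+ m + e12 * Sc w3 a c m.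
  have := Ssum_telescope c w3 m X1 X3 a0.
  by rewrite -opprB mulNr => /(congr1 -%R); rewrite opprK opprB => ->; rewrite addrC subrK.
(* The case of exponent 1 treats the bare factors [X2] and [X3], which account for the terms [Sb 1]
   and [Sc 1] in the entries. *)
have X2E := SbE 1%N; have X3E := ScE 1%N; rewrite !expr1 in X2E X3E.
have bXE k : bX w2 a b k = B ^+ k.
  by rewrite /bX exprZn expr_div_n -!exprM [(w2 * k)%N]mulnC.
case: t => [p q r|p q r|p q r|p q r|p q r|p q r b2 b3|p q r b2 b3] /=;
  rewrite ?bXE !(rmorphD, rmorphM, rmorphXn) ?th1 ?th2 ?th3;
  rewrite ?SbE ?ScE ?X2E ?X3E; ring.
Qed.

End Orbit.

(** * The ideal of the curve and the assembly of the factorization *)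

Lemma mps_of_inj (n : nat) (K : comNzRingType) : injective (@mps_of n K).
Proof. by move=> p q /(congr1 (fun f => f _)) pq; apply/mpolyP => m; exact: pq. Qed.

(** At the point (1, 1, 1) the equation takes the value 3 or 4, nonzero in characteristic zero. *)
Lemma sing_eq_neq0 (K : numFieldType) t : sing_eq K t != 0.
Proof.
apply/eqP => /(congr1 (meval (fun=> 1))); rewrite meval0 => /eqP.
have X1 i : ('X_i : {mpoly K[3]}).@[fun=> 1] = 1 by rewrite mevalXU.
have D1 : (1 + 1 + 1 : K) != 0
  by rewrite (_ : 1 + 1 + 1 = 3%:R) ?pnatr_eq0 //; ring.
have D2 : (1 + 1 + 1 + 1 : K) != 0
  by rewrite (_ : _ + _ = 4%:R) ?pnatr_eq0 //; ring.
by case: t => [p q r|p q r|p q r|p q r|p q r|p q r b2 b3|p q r b2 b3] /=;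
  rewrite !(rmorphD, rmorphM, rmorphXn) /= !X1 !expr1n ?mulr1 ?(negPf D1) ?(negPf D2).
Qed.

Lemma orbit_in_hypersurface (n : nat) (K : fieldType) (F : {mpoly K[n]}) w x :
  quasi_homogeneous w F -> hypersurface F x ->
  forall l : K, l != 0 -> F.@[weighted_scale w l x] = 0.
Proof.
move=> [d _ dF] Fx l l0; have /(congr1 (meval x)) := dF l l0.
rewrite comp_mpoly_meval mevalZ Fx mulr0 => <-; apply: meval_eq => i.
by rewrite tnth_mktuple mevalZ mevalXU.
Qed.

(** Taking the closure does not change the vanishing ideal. The closure is formed inside the
    hypersurface, so the orbit must lie there to be part of it. *)
Lemma vanishing_ideal_Cstar_curve (n : nat) (K : fieldType) (F : {mpoly K[n]}) w x h :
    (forall l : K, l != 0 -> F.@[weighted_scale w l x] = 0) ->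
  vanishing_ideal (Cstar_curve F w x) h
    <-> forall l : K, l != 0 -> h.@[weighted_scale w l x] = 0.
Proof.
move=> Fx; split=> [hD l l0|hO y [_ yD]].
  by apply: hD; split=> [|f]; [exact: Fx | apply; exists l].
by apply: yD => _ [l l0 <-]; exact: hO.
Qed.

Lemma entry11_orbit (K : fieldType) w2 w3 (a b c l : K) :
  (entry11 w2 a b).@[weighted_scale (vec3 1%N w2 w3) l (vec3 a b c)] = 0.
Proof.
rewrite mevalB !mevalZ rmorphXn /= !mevalXU /weighted_scale /vec3 /tnth /=.
by rewrite expr1 exprMn; ring.
Qed.

Lemma entry12_orbit (K : fieldType) w2 w3 (a b c l : K) :
  (entry12 w3 a c).@[weighted_scale (vec3 1%N w2 w3) l (vec3 a b c)] = 0.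
Proof.
rewrite mevalB !mevalZ rmorphXn /= !mevalXU /weighted_scale /vec3 /tnth /=.
by rewrite expr1 exprMn; ring.
Qed.

Lemma entries_koszul (K : fieldType) w2 w3 (a b c : K) (u v : {mps K[3]}) :
    (0 < w2)%N -> (0 < w3)%N -> a != 0 ->
    u * mps_of (entry11 w2 a b) + v * mps_of (entry12 w3 a c) = 0 ->
  exists t, u = t * mps_of (entry12 w3 a c) /\ v = - (t * mps_of (entry11 w2 a b)).
Proof.
move=> hw2 hw3 a0.
(* Both entries become binomials sharing the variable [X_1], with [X_2] and [X_3] as their linear
   variables; the coefficients of these are nonzero because [a] is. *)
have -> : entry11 w2 a b = (- a ^+ w2) *: 'X_(@Ordinal 3 1 isT)
    + b *: 'X_(@Ordinal 3 0 isT) ^+ w2 by rewrite scaleNr addrC.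
have -> : entry12 w3 a c = a ^+ w3 *: 'X_(@Ordinal 3 2 isT)
    + (- c) *: 'X_(@Ordinal 3 0 isT) ^+ w3 by rewrite scaleNr.
by apply: mps_koszul; rewrite ?oppr_eq0 ?expf_neq0.
Qed.

Lemma wunram_module_mf (K : numFieldType) (w2 w3 : nat) (t : sing_type) (a b c : K) :
    (0 < w2)%N -> (0 < w3)%N ->
    quasi_homogeneous (vec3 1%N w2 w3) (sing_eq K t) ->
    hypersurface (sing_eq K t) (vec3 a b c) -> a != 0 ->
  associated_mf
    (wunram_module (sing_eq K t)
       (Cstar_curve (sing_eq K t) (vec3 1%N w2 w3) (vec3 a b c)))
    (- mps_of (sing_eq K t))
    (\adj (mfA w2 w3 a b c t)) (mfA w2 w3 a b c t).
Proof.
move=> hw2 hw3 hqh hX ha.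
have FO := orbit_in_hypersurface hqh hX.
have detE : entry11 w2 a b * entry22 w2 a b t - entry12 w3 a c * entry21 w2 w3 a b c t
    = - sing_eq K t.
  (* This substitution kills the equation, which vanishes along the whole orbit, so only its
     negative survives in the determinant. *)
  pose theta : {rmorphism _ -> _} := X1_poly K \o along_curve w2 w3 a b c.
  rewrite (@entries_det _ w2 w3 a b c ha theta).
  - rewrite (_ : theta _ = 0) ?sub0r //.
    exact: etrans (congr1 (X1_poly K) (along_curve_eq0 ha FO)) (raddf0 _).
  - exact: along_curveX1.
  - exact: along_curveX2.
  - exact: along_curveX3.
apply: (@hom_ideal_mf _ _ (mps_of (entry11 w2 a b)) (mps_of (entry12 w3 a c))
  (mps_of (entry21 w2 w3 a b c t)) (mps_of (entry22 w2 a b t)));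
  try by rewrite !mxE.
- by rewrite -!rmorphM -!raddfB detE raddfN.
- move=> x xF; apply: (@mps_mulf_eq0 3 K (mps_of (sing_eq K t))).
    by rewrite mulrC.
  by rewrite -(raddf0 (@mps_of 3 K)) (inj_eq (@mps_of_inj _ _)) sing_eq_neq0.
- by move=> u v; exact: entries_koszul.
(* The extended ideal of the curve is generated by the first row: polynomials vanishing on the curve
   are combinations of the two entries, and conversely both entries vanish on the orbit. *)
move=> x; split.
  move=> /asboolP[s [u [v [vA ->]]]].
  apply: (big_ind (fun y => exists p q, y = qclass _
    (p * mps_of (entry11 w2 a b) + q * mps_of (entry12 w3 a c)))).
  - by exists 0, 0; rewrite !mul0r addr0 raddf0.
  - move=> _ _ [p [q ->]] [p' [q' ->]]; exists (p + p'), (q + q').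
    by rewrite -raddfD; congr (qclass _ _); ring.
  move=> i _; have [h hD <-] := vA i.
  have [r ->] := qclass_surj (u i).
  have [p [q hE]] := vanishing_curve_ideal ha
    ((vanishing_ideal_Cstar_curve _ FO).1 hD).
  exists (r * mps_of p), (r * mps_of q).
  rewrite -rmorphM; congr (qclass _ _); rewrite hE rmorphD !rmorphM; ring.
move=> [u [v ->]]; apply/asboolP.
exists 2%N, (fun i => if i == 0 then qclass _ u else qclass _ v).
exists (fun i => if i == 0 then qclass _ (mps_of (entry11 w2 a b))
                 else qclass _ (mps_of (entry12 w3 a c))).
split=> [i|]; last by rewrite big_ord_recl big_ord1 /= -!rmorphM -raddfD.
case: ifP => _; eexists; try reflexivity.
  apply/(vanishing_ideal_Cstar_curve _ FO) => l _; exact: entry11_orbit.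
apply/(vanishing_ideal_Cstar_curve _ FO) => l _; exact: entry12_orbit.
Qed.

Theorem theorem1p2 (R : realType) (w2 w3 : nat) (t : sing_type)
  (hw2 : (0 < w2)%N) (hw3 : (0 < w3)%N) (ht : admissible t)
  (hqh : quasi_homogeneous (vec3 1%N w2 w3) (sing_eq R[i] t))
  (hiso : isolated_singularity (sing_eq R[i] t))
  (a b c : R[i])
  (hX : hypersurface (sing_eq R[i] t) (vec3 a b c)) (ha : a != 0) :
  associated_mf
    (wunram_module (sing_eq R[i] t)
       (Cstar_curve (sing_eq R[i] t) (vec3 1%N w2 w3) (vec3 a b c)))
    (- mps_of (sing_eq R[i] t))
    (\adj (mfA w2 w3 a b c t)) (mfA w2 w3 a b c t).
Proof. exact: wunram_module_mf. Qed.
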